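(* Let $(X,d)$ be a proper metric space with a bicombing $\sigma$ and cocompact isometry group. Let $n$ be a positive integer and suppose there are a sequence $R_k\in(0,\infty)$, a sequence of subsets $S_k\subset X$, and a norm $\|\cdot\|$ on $\mathbb{R}^n$ such that $R_k\to\infty$ and the rescaled sets $\frac{1}{R_k}S_k$ (that is, $S_k$ with the metric $\frac{1}{R_k}d$) converge to the closed unit ball $B\subset(\mathbb{R}^n,\|\cdot\|)$ in the Gromov-Hausdorff topology as $k\to\infty$. Then $(\mathbb{R}^n,\|\cdot\|)$ can be isometrically embedded in $X$ (i.e. there is a distance-preserving map $(\mathbb{R}^n,\|\cdot\|)\to X$).
   Context: A bicombing on a metric space $(X,d)$ is a map $\sigma\colon X\times X\times[0,1]\to X$, written $\sigma_{xy}(t):=\sigma(x,y,t)$, such that for all $x,y\in X$ one has $\sigma_{xy}(0)=x$, $\sigma_{xy}(1)=y$ and $d(\sigma_{xy}(t),\sigma_{xy}(t'))=|t-t'|\,d(x,y)$ for all $t,t'\in[0,1]$, and such that the conical property holds: $d(\sigma_{xy}(t),\sigma_{x'y'}(t))\le(1-t)\,d(x,x')+t\,d(y,y')$ for all $t\in[0,1]$ and all $x,y,x',y'\in X$. No equivariance of $\sigma$ under isometries is assumed. A metric space is proper if all closed balls are compact. $X$ has cocompact isometry group if there is a compact set $K\subset X$ whose translates under the isometry group of $X$ cover $X$. *)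

(* Defs.v *)
From HB Require Import structures.
From mathcomp Require Export all_boot all_order all_algebra.
From mathcomp Require Export all_classical all_reals all_analysis.
Export Order.TTheory GRing.Theory Num.Theory.
Export numFieldNormedType.Exports.

Set Implicit Arguments.
Unset Strict Implicit.
Unset Printing Implicit Defensive.

Local Open Scope classical_set_scope.
Local Open Scope ring_scope.

(* [sigma x y t] is only constrained for [t] in [0, 1]; its values for other
   [t] are irrelevant. *)
Record bicombing (R : realType) (X : metricType R) (sigma : X -> X -> R -> X) :
    Prop := Bicombing {
  bicombing0 : forall x y, sigma x y 0 = x ;
  bicombing1 : forall x y, sigma x y 1 = y ;
  bicombing_geodesic : forall x y t t', 0 <= t <= 1 -> 0 <= t' <= 1 ->
    mdist (sigma x y t) (sigma x y t') = `|t - t'| * mdist x y ;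
  bicombing_conical : forall x y x' y' t, 0 <= t <= 1 ->
    mdist (sigma x y t) (sigma x' y' t)
      <= (1 - t) * mdist x x' + t * mdist y y' }.

(* In a general metric space this may be larger than the library's
   [closed_ball], which is the closure of the open ball. *)
Definition mclosed_ball (R : realType) (X : metricType R) (x : X) (r : R) :
  set X := [set y | mdist x y <= r].

Definition proper_space (R : realType) (X : metricType R) : Prop :=
  forall (x : X) (r : R), compact (mclosed_ball x r).

Definition isometry_group (R : realType) (X : metricType R) : set (X -> X) :=
  [set g | (forall x y, mdist (g x) (g y) = mdist x y) /\ bijective g].

Definition cocompact_isometry_group (R : realType) (X : metricType R) : Prop :=
  exists2 K : set X, compact K &
    \bigcup_(g in @isometry_group R X) (g @` K) = setT.

(* A norm is a function on row vectors rather than a [normedModType] because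
   ['rV[R]_n] already carries the sup norm canonically. *)
Record is_norm (R : realType) (n : nat) (N : 'rV[R]_n -> R) : Prop := IsNorm {
  is_norm_eq0 : forall v, N v = 0 -> v = 0 ;
  is_normZ : forall (a : R) v, N (a *: v) = `|a| * N v ;
  is_normD : forall u v, N (u + v) <= N u + N v }.

(* inf {r > 0 | P is in the open r-neighbourhood of Q and conversely}, which is
   +oo if there is no such r. *)
Definition hausdorff_dist (R : realType) (Z : metricType R) (P Q : set Z) :
    \bar R :=
  ereal_inf [set r%:E | r in [set r : R | [/\ 0 < r,
    P `<=` \bigcup_(q in Q) ball q r & Q `<=` \bigcup_(p in P) ball p r]]].

Definition isometric_on (R : realType) (A : Type) (dA : A -> A -> R)
    (P : set A) (Z : metricType R) (f : A -> Z) : Prop :=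
  forall x y, P x -> P y -> mdist (f x) (f y) = dA x y.

(* Gromov-Hausdorff distance between the metric spaces [(P, dA)] and [(Q, dB)]:
   the infimum of the Hausdorff distances between their images under isometric
   embeddings in a common metric space. *)
Definition gromov_hausdorff_dist (R : realType)
    (A : Type) (dA : A -> A -> R) (P : set A)
    (B : Type) (dB : B -> B -> R) (Q : set B) : \bar R :=
  ereal_inf [set e | exists (Z : metricType R) (f : A -> Z) (g : B -> Z),
    [/\ isometric_on dA P f, isometric_on dB Q g &
        e = hausdorff_dist (f @` P) (g @` Q)]].

(* Main.v *)
(** A bicombing yields a symmetric midpoint map [m] with the conical property:
    replacing [(x, y)] by the pair of midpoints of [(x, y)] and [(y, x)] halves
    the distance, and [m x y] is the limit.  For [f] defined on a ball of the
    normed space put [T_v f x = m (f x) (f (x + v))].  This operator commutes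
    with translations, does not increase sup-distances, and by symmetry of [m]
    halves the displacement bound along [2v] into one along [v].  Applying
    [T_(2^(k-1) v)], ..., [T_v] therefore turns the bound
    [2^k N v + delta * rho] for a coarse almost isometry of the ball of radius
    [rho] into [N v + delta * rho / 2^k], where [2^k] is comparable to [rho];
    this is done for finitely many directions [v] one after the other.  The smoothed map
    still almost preserves large distances, so on most unit steps of a long
    segment the bound [N v] is almost attained, and averaging over a grid gives
    a base point at which this happens for all the directions at once.  Hence
    every finite subset of the normed space embeds in [X] with arbitrarily small
    additive error; cocompactness and an ultralimit give the isometric
    embedding. *)
From mathcomp Require Import ring lra zify.
Require Import Defs.

Set Implicit Arguments.
Unset Strict Implicit.
Unset Printing Implicit Defensive.

Local Open Scope classical_set_scope.
Local Open Scope ring_scope.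

(** * Limits along an ultrafilter *)

(** Compactness gives a cluster point of the image filter. For an ultrafilter it is a limit:
    otherwise the indices far from it would form a set of [U], whose image meets every ball around
    it. *)
Lemma compact_ultralimit (R : realType) (X : metricType R) (K : set X)
    (I : Type) (U : set_system I) (h : I -> X) :
  UltraFilter U -> compact K -> U (h @^-1` K) ->
  exists l, forall e, 0 < e -> U [set i | mdist (h i) l < e].
Proof.
move=> uU cK UK; have [l [_ hl]] := cK (h @ U) _ UK; exists l => e e0.
have [//|Ufar] := in_ultra_setVsetC [set i | mdist (h i) l < e] uU.
have [_ [/= [i far <-]]] := hl (h @` (~` [set i | mdist (h i) l < e])) _
  (filterS (@preimage_image _ _ h _) Ufar) (nbhsx_ballx l e e0).
by rewrite ballEmdist/= metric_sym => /far.
Qed.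

(** * Symmetric midpoints *)

Section midpoint.
Context {R : realType} {X : metricType R} {sigma : X -> X -> R -> X}.
Hypothesis bs : bicombing sigma.
Implicit Types x y z : X.

Let mid x y := sigma x y 2^-1.

Let half01 : 0 <= (2^-1 : R) <= 1. Proof. by apply/andP; split; lra. Qed.

Lemma bicombing_mid_id x : mid x x = x.
Proof.
apply: mdist_positivity; rewrite /mid -{3}(bicombing0 bs x x).
by rewrite (bicombing_geodesic bs)// ?mdistxx ?mulr0// lexx ler01.
Qed.

Lemma bicombing_mid_conical x y x' y' :
  mdist (mid x y) (mid x' y') <= (mdist x x' + mdist y y') / 2.
Proof. by have := bicombing_conical bs x y x' y' half01; rewrite /mid; lra. Qed.

(* Apply the conical inequality to [mid x y] and the constant segment at
   [mid y x], whose distance to both [x] and [y] is half of [mdist x y]. *)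
Lemma bicombing_mid_swap x y : mdist (mid x y) (mid y x) <= mdist x y / 2.
Proof.
have := bicombing_mid_conical x y (mid y x) (mid y x).
have := bicombing_mid_conical x x y x.
have := bicombing_mid_conical y y y x.
rewrite !bicombing_mid_id !mdistxx (metric_sym y x); lra.
Qed.

(** Exchanging [x] and [y] merely swaps the two entries of each successive pair, so the asymmetry
    shrinks with the pair itself. *)
Fixpoint iter_mid i x y :=
  if i is j.+1 then iter_mid j (mid x y) (mid y x) else mid x y.

Lemma iter_mid_id i x : iter_mid i x x = x.
Proof. by elim: i => [|i IH]/=; rewrite bicombing_mid_id. Qed.

Lemma iter_mid_conical i x y x' y' :
  mdist (iter_mid i x y) (iter_mid i x' y') <= (mdist x x' + mdist y y') / 2.
Proof.
elim: i x y x' y' => [|i IH] x y x' y' /=; first exact: bicombing_mid_conical.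
apply: le_trans (IH _ _ _ _) _.
have := bicombing_mid_conical x y x' y'.
have := bicombing_mid_conical y x y' x'; lra.
Qed.

Lemma iter_mid_swap i x y :
  mdist (iter_mid i x y) (iter_mid i y x) <= mdist x y / 2 ^+ i.
Proof.
elim: i x y => [|i IH] x y /=.
  by have := bicombing_mid_swap x y; have := mdist_ge0 x y; rewrite expr0; lra.
apply: le_trans (IH _ _) _; rewrite exprS invfM mulrA.
by rewrite ler_pM2r ?invr_gt0 ?exprn_gt0//; exact: bicombing_mid_swap.
Qed.

Lemma symmetric_midpoint : proper_space X ->
  exists m : X -> X -> X, [/\ forall x y, m x y = m y x, forall x, m x x = x &
    forall x y x' y', mdist (m x y) (m x' y') <= (mdist x x' + mdist y y') / 2].
Proof.
move=> pX; have [U [uU sU]] := @ultraFilterLemma nat \oo _.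
have lim_mid (p : X * X) : exists l, forall e, 0 < e ->
    U [set i | mdist (iter_mid i p.1 p.2) l < e].
  case: p => x y /=.
  (* Comparison with the constant sequence [iter_mid i x x = x] keeps the iterates in this ball. *)
  apply: (compact_ultralimit _ (pX x (mdist x y / 2))).
  apply: filterE => i; rewrite /mclosed_ball/= -{1}(iter_mid_id i x).
  by apply: le_trans (iter_mid_conical _ _ _ _ _) _; rewrite mdistxx add0r.
have [m0 m0P] := choice lim_mid.
pose m x y := m0 (x, y).
have mP x y e : 0 < e -> U [set i | mdist (iter_mid i x y) (m x y) < e].
  exact: (m0P (x, y)).
have m_conical x y x' y' :
    mdist (m x y) (m x' y') <= (mdist x x' + mdist y y') / 2.
  apply/ler_addgt0Pr => e e0; have e2 : 0 < e / 2 by lra.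
  have [i [/= h1 h2]] := filter_ex (filterI (mP x y _ e2) (mP x' y' _ e2)).
  have := metric_triangle (m x y) (iter_mid i x y) (m x' y').
  have := metric_triangle (iter_mid i x y) (iter_mid i x' y') (m x' y').
  have := iter_mid_conical i x y x' y'.
  rewrite (metric_sym (m x y) (iter_mid i x y)); lra.
exists m; split=> //.
- move=> x y; apply: mdist_positivity; apply/eqP; rewrite eq_le mdist_ge0 andbT.
  apply/ler_addgt0Pr => e e0; have e3 : 0 < e / 3 by lra.
  have Uswap : U [set i | mdist x y / 2 ^+ i < e / 3].
    apply: sU; have: mdist x y / 2 ^+ i @[i --> \oo] --> (0 : R); last first.
      by move/cvgr_lt; exact.
    rewrite -[0](mulr0 (mdist x y)); apply: cvgMr.
    under eq_fun do rewrite -exprVn.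
    by apply: cvg_expr; rewrite ger0_norm; lra.
  have [i [/= [h1 h2] h3]] :=
    filter_ex (filterI (filterI (mP x y _ e3) (mP y x _ e3)) Uswap).
  have := metric_triangle (m x y) (iter_mid i x y) (m y x).
  have := metric_triangle (iter_mid i x y) (iter_mid i y x) (m y x).
  have := iter_mid_swap i x y.
  rewrite (metric_sym (m x y) (iter_mid i x y)); lra.
- move=> x; apply: mdist_positivity; apply/eqP; rewrite eq_le mdist_ge0 andbT.
  apply/ler_addgt0Pr => e e0; have [i /=] := filter_ex (mP x x _ e0).
  by rewrite iter_mid_id metric_sym add0r => /ltW.
Qed.

End midpoint.
(** * Averages over grids *)

Section norm.
Context {R : realType} {n : nat} {N : 'rV[R]_n -> R}.
Hypothesis nN : is_norm N.
Implicit Types u v w x y : 'rV[R]_n.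

Lemma is_norm0 : N 0 = 0.
Proof. by rewrite -(scale0r 0) (is_normZ nN) normr0 mul0r. Qed.

Lemma is_normN v : N (- v) = N v.
Proof. by rewrite -scaleN1r (is_normZ nN) normrN normr1 mul1r. Qed.

Lemma is_normBC u v : N (u - v) = N (v - u).
Proof. by rewrite -is_normN opprB. Qed.

Lemma is_norm_ge0 v : 0 <= N v.
Proof.
by have := is_normD nN v (- v); rewrite subrr is_norm0 is_normN; lra.
Qed.

Lemma is_normZ_ge0 (a : R) v : 0 <= a -> N (a *: v) = a * N v.
Proof. by move=> a0; rewrite (is_normZ nN) ger0_norm. Qed.

(** Induction on the directions: averaging over [A] steps along one direction commutes with
    translations, so it preserves the average bounds along the others. The resulting average over
    the whole grid is attained or undercut at some grid point. *)
Lemma is_norm_grid_pigeonhole (I : eqType) (L : seq I) (v : I -> 'rV[R]_n)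
    (phi : I -> 'rV[R]_n -> R) (A : nat) (b rho : R) :
    (0 < A)%N ->
    (forall i x, i \in L -> N x <= rho ->
      \sum_(j < A) phi i (x + j%:R *: v i) <= A%:R * b) ->
    A%:R * \sum_(i <- L) N (v i) <= rho ->
  exists2 x, N x <= A%:R * \sum_(i <- L) N (v i) &
    \sum_(i <- L) phi i x <= (size L)%:R * b.
Proof.
move=> A0; have A0' : 0 < A%:R :> R by rewrite ltr0n.
elim: L phi rho => [|i0 L IH] phi rho phib Arho.
  by exists 0; rewrite !big_nil ?is_norm0 ?mulr0 ?mul0r.
rewrite big_cons in Arho.
have step x (j : nat) : (j <= A)%N ->
    N (x + j%:R *: v i0) <= N x + A%:R * N (v i0).
  move=> jA; apply: le_trans (is_normD nN _ _) _.
  by rewrite is_normZ_ge0// lerD2l ler_wpM2r ?is_norm_ge0// ler_nat.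
pose psi i x := (\sum_(j < A) phi i (x + j%:R *: v i0)) / A%:R.
(* The radius shrinks so that all translates entering [psi] stay in the ball of radius [rho]. *)
have [||y yr psiy] := IH psi (rho - A%:R * N (v i0)).
- move=> i x iL xr; rewrite -mulr_suml exchange_big/=.
  have -> : A%:R * b = (\sum_(j < A) A%:R * b) / A%:R.
    by rewrite sumr_const card_ord -[(_ * b) *+ A]mulr_natr mulfK ?gt_eqF.
  rewrite ler_pM2r ?invr_gt0//; apply: ler_sum => j _.
  under eq_bigr do rewrite addrAC.
  apply: phib; first by rewrite inE iL orbT.
  by apply: le_trans (step _ _ (ltnW (ltn_ord j))) _; lra.
- by rewrite mulrDr in Arho; lra.
rewrite mulrDr in Arho.
have sumb : \sum_(j < A) (\sum_(i <- i0 :: L) phi i (y + j%:R *: v i0))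
    <= \sum_(j < A) ((size L).+1%:R * b).
  under eq_bigr do rewrite big_cons.
  rewrite big_split/= sumr_const card_ord -[leRHS]mulr_natl mulrSr mulrDl.
  rewrite mul1r mulrDr addrC lerD//; last first.
    apply: phib; first exact: mem_head.
    by apply: le_trans yr _; have := is_norm_ge0 (v i0); nra.
  move: psiy; rewrite /psi -mulr_suml ler_pdivrMr// mulrC exchange_big/=.
  by rewrite mulrC.
have [j jP] : exists j : 'I_A,
    \sum_(i <- i0 :: L) phi i (y + j%:R *: v i0) <= (size L).+1%:R * b.
  apply: contrapT => nj; move: sumb; apply/negP; rewrite -ltNge.
  apply: ltr_sum => [|j _]; last first.
    by rewrite ltNge; apply/negP => ?; apply: nj; exists j.
  by apply/hasP; exists (Ordinal A0) => //; rewrite mem_index_enum.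
exists (y + j%:R *: v i0) => //.
by rewrite big_cons mulrDr; have := step y j (ltnW (ltn_ord j)); lra.
Qed.

End norm.

(** * Smoothing along finitely many directions *)

Section smoothing.
Context {R : realType} {X : metricType R} {n : nat} {N : 'rV[R]_n -> R}.
Context {m : X -> X -> X}.
Hypothesis nN : is_norm N.
Hypothesis mC : forall x y, m x y = m y x.
Hypothesis m_id : forall x, m x x = x.
Hypothesis m_conical : forall x y x' y',
  mdist (m x y) (m x' y') <= (mdist x x' + mdist y y') / 2.
Implicit Types (f g : 'rV[R]_n -> X) (v w x z : 'rV[R]_n).

Definition increment_le (rho : R) f w (eta : R) :=
  forall x, N x <= rho -> N (x + w) <= rho -> mdist (f x) (f (x + w)) <= eta.

(* [f'] is obtained from [f] by translation invariant averages over points at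
   distance at most [s]. *)
Definition averaged (s : R) f f' :=
  (forall rho w eta, increment_le rho f w eta ->
    increment_le (rho - s) f' w eta) /\
  (forall rho z p e,
    (forall x, N x <= rho -> mdist (f x) p <= N (x - z) + e) ->
    forall x, N x <= rho - s -> mdist (f' x) p <= N (x - z) + (e + s)).

Lemma averaged_refl f : averaged 0 f f.
Proof.
split=> [rho w eta|rho z p e] h x; rewrite subr0; first exact: h.
by rewrite addr0; exact: h.
Qed.

Lemma averaged_trans s t f g h :
  averaged s f g -> averaged t g h -> averaged (s + t) f h.
Proof.
move=> [fg1 fg2] [gh1 gh2]; split=> [rho w eta|rho z p e] H.
  by rewrite opprD addrA; exact/gh1/fg1.
by move=> x; have := gh2 _ _ _ _ (fg2 _ _ _ _ H) x; rewrite -!addrA -opprD.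
Qed.

Definition shift_mid v f : 'rV[R]_n -> X := fun x => m (f x) (f (x + v)).

Lemma averaged_shift_mid v f : averaged (N v) f (shift_mid v f).
Proof.
split=> [rho w eta|rho z p e] H x xr.
  move=> xwr; have := m_conical (f x) (f (x + v)) (f (x + w)) (f (x + w + v)).
  have := H x; have := H (x + v); have := is_normD nN x v.
  have := is_normD nN (x + w) v; have := is_norm_ge0 nN v.
  rewrite /shift_mid (addrAC x w) => v0 h1 h2 h3 h4.
  by have := h3 ltac:(lra) ltac:(lra); have := h4 ltac:(lra) ltac:(lra); lra.
have := m_conical (f x) (f (x + v)) p p.
have := H x; have := H (x + v); have := is_normD nN x v.
have := is_normD nN (x - z) v; have := is_norm_ge0 nN v.
rewrite /shift_mid m_id (addrAC x v) => v0 h1 h2 h3 h4.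
by have := h3 ltac:(lra); have := h4 ltac:(lra); lra.
Qed.

(* By symmetry of [m], the values [m (f x) (f (x + v))] and
   [m (f (x + v)) (f (x + 2v))] share the entry [f (x + v)]. *)
Lemma increment_shift_mid rho v f eta : increment_le rho f (2 *: v) eta ->
  increment_le (rho - N v) (shift_mid v f) v (eta / 2).
Proof.
move=> H x xr xvr; rewrite /shift_mid (mC (f (x + v))).
apply: le_trans (m_conical _ _ _ _) _; rewrite mdistxx addr0 ler_pM2r//.
have v2 : x + v + v = x + 2 *: v by rewrite scaler_nat mulr2n addrA.
have := is_normD nN (x + v) v; have := is_norm_ge0 nN v.
by rewrite v2 => v0 h; apply: H; lra.
Qed.

Fixpoint dyadic_smooth k v f :=
  if k is j.+1 then shift_mid v (dyadic_smooth j (2 *: v) f) else f.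

(** The shifts [v], [2 v], ..., [2 ^ (k - 1) v] have norms adding up to [(2 ^ k - 1) * N v]. *)
Lemma averaged_dyadic_smooth k v f :
  averaged ((2 ^+ k - 1) * N v) f (dyadic_smooth k v f).
Proof.
elim: k v => [|k IH] v /=.
  by rewrite expr0 subrr mul0r; exact: averaged_refl.
have -> : (2 ^+ k.+1 - 1) * N v = (2 ^+ k - 1) * N (2 *: v) + N v.
  by rewrite (is_normZ_ge0 nN)// exprS; ring.
exact: averaged_trans (IH _) (averaged_shift_mid _ _).
Qed.

Lemma increment_dyadic_smooth k rho v f eta :
  increment_le rho f (2 ^+ k *: v) eta ->
  increment_le (rho - (2 ^+ k - 1) * N v) (dyadic_smooth k v f) v
    (eta / 2 ^+ k).
Proof.
elim: k v => [|k IH] v /=.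
  by rewrite expr0 subrr mul0r subr0 divr1 scale1r.
rewrite exprSr -scalerA => /IH/increment_shift_mid.
rewrite (is_normZ_ge0 nN)// invfM [eta * (_ * _)]mulrA.
have -> // : rho - (2 ^+ k - 1) * (2 * N v) - N v
           = rho - (2 ^+ k * 2 - 1) * N v by ring.
Qed.

(** Smoothing along one direction preserves increment bounds along every vector. Hence it spoils
    neither the bounds already improved nor those still to be improved. *)
Lemma smooth_directions k (D : seq 'rV[R]_n) f : exists f',
  averaged ((2 ^+ k - 1) * \sum_(v <- D) N v) f f' /\
  forall v rho eta, v \in D -> increment_le rho f (2 ^+ k *: v) eta ->
    increment_le (rho - (2 ^+ k - 1) * \sum_(v <- D) N v) f' v (eta / 2 ^+ k).
Proof.
elim: D => [|v D [f1 [av1 inc1]]].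
  by exists f; rewrite big_nil mulr0; split=> //; exact: averaged_refl.
have av := averaged_dyadic_smooth k v f1.
exists (dyadic_smooth k v f1); rewrite big_cons mulrDr addrC; split.
  exact: averaged_trans av1 av.
move=> w rho eta; rewrite inE opprD addrA => /predU1P[->|wD] H.
  by apply: increment_dyadic_smooth; apply: av1.1.
by apply: av.1; exact: inc1.
Qed.

(** * Almost isometries of finite sets *)

Lemma mdist_telescope (h : nat -> X) (A : nat) :
  mdist (h 0) (h A) <= \sum_(j < A) mdist (h j) (h j.+1).
Proof.
elim: A => [|A IH]; first by rewrite big_ord0 mdistxx.
by rewrite big_ord_recr/=; have := metric_triangle (h 0) (h A) (h A.+1); lra.
Qed.

Lemma dyadic_scale (x : R) : 1 <= x -> exists k, 2 ^+ k <= x < 2 ^+ k.+1.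
Proof.
move=> x1; have x0 : 0 <= x by lra.
have /andP[tx xt] := truncn_itv x0; exists (trunc_log 2 (Num.truncn x)).
have t0 : (0 < Num.truncn x)%N by rewrite truncn_ge_nat.
apply/andP; split.
  by apply: le_trans tx; rewrite -natrX ler_nat trunc_logP.
by apply: lt_le_trans xt _; rewrite -natrX ler_nat trunc_log_ltn.
Qed.

(** The error is small only relative to the radius [rho], as Gromov-Hausdorff closeness after
    rescaling provides. *)
Definition almost_isometries_on_balls := forall delta M : R, 0 < delta ->
  exists (rho : R) (g : 'rV[R]_n -> X), M <= rho /\
    forall x y, N x <= rho -> N y <= rho ->
      `|mdist (g x) (g y) - N (x - y)| <= delta * rho.

Lemma finite_almost_isometry (P : seq 'rV[R]_n) (eps : R) :
    almost_isometries_on_balls -> 0 < eps ->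
  exists f : 'rV[R]_n -> X, forall p q, p \in P -> q \in P ->
    `|mdist (f p) (f q) - N (p - q)| <= eps.
Proof.
move=> big eps0.
pose L := [seq (p, q) | p <- P, q <- P].
pose dir (pq : 'rV[R]_n * 'rV[R]_n) := pq.2 - pq.1.
pose S := \sum_(pq <- L) N (dir pq).
pose C := \sum_(p <- P) N p.
pose s : R := (size L)%:R.
have S0 : 0 <= S by apply: sumr_ge0 => *; exact: is_norm_ge0.
have C0 : 0 <= C by apply: sumr_ge0 => *; exact: is_norm_ge0.
have s0 : 0 <= s by exact: ler0n.
have term_le (T : eqType) (t : T) (l : seq T) (h : T -> R) :
    (forall u, u \in l -> 0 <= h u) -> t \in l -> h t <= \sum_(u <- l) h u.
  move=> h0 tl; rewrite (big_rem t tl)/= lerDl big_seq sumr_ge0// => u /mem_rem.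
  exact: h0.
(* [Q] makes the distance [2 ^+ k * S] by which smoothing moves points small
   compared with the size [A = Q * 2 ^+ k] of the grid. *)
have [Q Q0 QP] : exists2 Q : nat, (0 < Q)%N & s * (2 * S) <= Q%:R * (eps / 2).
  pose x := s * (2 * S) / (eps / 2).
  have x0 : 0 <= x by rewrite /x divr_ge0 ?mulr_ge0//; lra.
  exists (Num.truncn x).+1 => //.
  have /andP[_ /ltW] := truncn_itv x0.
  by rewrite /x ler_pdivrMr//; lra.
have Q1 : 1 <= Q%:R :> R by rewrite ler1n.
(* A ball of radius [c * l], with [l = 2 ^ k], has room for a base point of norm at most [A * S], a
   translation by a point of [P], a progression of length at most [A * S], and the margin [l * S]
   lost to smoothing. *)
pose c := (2 * Q%:R + 1) * S + C + 1.
have c1 : 1 <= c by rewrite /c; nra.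
(* Since [eta <= 2 * c * delta] below, this makes [s * (4 * eta)] at most [eps / 2]. *)
pose delta := eps / (16 * c * (s + 1)).
have den0 : 0 < 16 * c * (s + 1) by nra.
have delta0 : 0 < delta by rewrite divr_gt0.
have deltaE : delta * (16 * c * (s + 1)) = eps by rewrite divfK ?gt_eqF.
have [rho [g [crho gP]]] := big delta c delta0.
have [|k /andP[k1 k2]] := @dyadic_scale (rho / c).
  by rewrite ler_pdivlMr ?mul1r//; lra.
pose l : R := 2 ^+ k.
have l1 : 1 <= l by rewrite exprn_ege1 ?ler1n.
have l0 : 0 < l by lra.
have crl : c * l <= rho by move: k1; rewrite -/l ler_pdivlMr; lra.
have rcl : rho <= 2 * c * l.
  by move: k2; rewrite ltr_pdivrMr ?exprS; [rewrite -/l; lra|lra].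
pose eta := delta * rho / l.
have etaE : eta * l = delta * rho by rewrite divfK//; lra.
have eta0 : 0 <= eta by rewrite /eta !mulr_ge0 ?invr_ge0; lra.
have eta_le : eta <= delta * (2 * c).
  by rewrite -(ler_pM2r l0) etaE; have := ler_wpM2l (ltW delta0) rcl; lra.
have [f [[_ f_near] f_inc]] := smooth_directions k [seq dir pq | pq <- L] g.
rewrite big_map -/S -/l in f_near f_inc.
have f_near_g x : N x <= rho - l * S ->
    mdist (f x) (g x) <= delta * rho + l * S.
  (* The second clause of [averaged] is used with [z = x] and [p = g x]. *)
  move=> xr; have := f_near rho x (g x) (delta * rho) _ x _.
  rewrite subrr is_norm0// add0r => near.
  have xr' : N x <= rho - (l - 1) * S by lra.
  apply: le_trans (near _ xr') _ => [y yr|]; last by lra.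
  by have := gP y x yr; rewrite ler_norml => /(_ _)/andP[|_]; nra.
have f_lower x y : N x <= rho - l * S -> N y <= rho - l * S ->
    N (x - y) - 3 * (delta * rho) - 2 * (l * S) <= mdist (f x) (f y).
  move=> xr yr; have lS : 0 <= l * S by nra.
  have := gP x y ltac:(lra) ltac:(lra); rewrite ler_norml => /andP[gxy _].
  have := f_near_g x xr; have := f_near_g y yr.
  have := metric_triangle (g x) (f x) (g y).
  have := metric_triangle (f x) (f y) (g y).
  by rewrite (metric_sym (g x) (f x)); lra.
have f_upper x v : v \in [seq dir pq | pq <- L] -> N x <= rho - l * S ->
    N (x + v) <= rho - l * S -> mdist (f x) (f (x + v)) <= N v + eta.
  move=> vL xr xvr.
  have inc_g : increment_le rho g (l *: v) (l * N v + delta * rho).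
    move=> y yr ylr; have := gP y (y + l *: v) yr ylr.
    rewrite ler_norml => /andP[_]; rewrite opprD addrA subrr add0r is_normN//.
    by rewrite is_normZ_ge0//; lra.
  have <- : (l * N v + delta * rho) / l = N v + eta.
    by rewrite /eta; field; rewrite gt_eqF.
  by apply: (f_inc v _ _ vL inc_g x); lra.
pose A := (Q * 2 ^ k)%N.
have A0 : (0 < A)%N by rewrite muln_gt0 Q0 expn_gt0.
have AE : A%:R = Q%:R * l :> R by rewrite natrM natrX.
(* The defect of the pair in the upper bound [f_upper]. *)
pose phi (pq : 'rV[R]_n * 'rV[R]_n) x :=
  N (dir pq) + eta - mdist (f (x + pq.1)) (f (x + pq.2)).
(* Over [A] steps the defects add up to at most [A * eta + 3 * delta * rho + 2 * l * S]. Here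
   [delta * rho = eta * l <= A * eta], and division by [A = Q * l] gives [b]. *)
pose b := 4 * eta + 2 * S / Q%:R.
have in_range x p (j : nat) pq : N x <= A%:R * S -> p \in P -> pq \in L ->
    (j <= A)%N -> N (x + p + j%:R *: dir pq) <= rho - l * S.
  move=> xr pP pqL jA; have := is_normD nN (x + p) (j%:R *: dir pq).
  have := is_normD nN x p; rewrite (is_normZ_ge0 nN)//.
  have : N p <= C by apply: term_le => // *; exact: is_norm_ge0.
  have : j%:R * N (dir pq) <= A%:R * S.
    rewrite ler_pM ?ler0n ?is_norm_ge0 ?ler_nat//.
    by apply: (term_le _ _ _ (fun u => N (dir u))) => // *; exact: is_norm_ge0.
  have : C <= C * l by nra.
  by move: xr crl; rewrite /c AE; lra.
have phi_ge0 pq x : pq \in L -> N x <= A%:R * S -> 0 <= phi pq x.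
  move=> pqL xr; have := pqL => /allpairsP[[p q] /= [pP qP pqE]].
  have := in_range x p 0 pq xr pP pqL; have := in_range x p 1 pq xr pP pqL A0.
  rewrite scale0r scale1r addr0 => h1 h0.
  have := f_upper (x + p) (dir pq) (map_f _ pqL) (h0 isT) h1.
  by rewrite /phi pqE /dir/= addrA -(addrA x) [p + q]addrC addrA addrK; lra.
have phi_avg pq x : pq \in L -> N x <= A%:R * S ->
    \sum_(j < A) phi pq (x + j%:R *: dir pq) <= A%:R * b.
  move=> pqL xr; have := pqL => /allpairsP[[p q] /= [pP qP pqE]].
  (* Because [dir pq = q - p], each translated pair ends where the next one starts, so the triangle
     inequality bounds the sum of the distances below by the distance of the end points. *)
  pose h (j : nat) := f (x + p + j%:R *: dir pq).
  have phiE (j : nat) : phi pq (x + j%:R *: dir pq)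
      = N (dir pq) + eta - mdist (h j) (h j.+1).
    pose d := q - p; have qE : q = d + p by rewrite subrK.
    rewrite /phi /h pqE /dir/= -/d; congr (_ - mdist (f _) (f _)).
      exact: addrAC.
    by rewrite [in LHS]qE -natr1 scalerDl scale1r [RHS]addrAC !addrA.
  under eq_bigr do rewrite phiE.
  rewrite sumrB sumr_const card_ord -[(_ + _) *+ A]mulr_natl.
  have := mdist_telescope h A; rewrite {1 2}/h scale0r addr0.
  have h0 := in_range x p 0 pq xr pP pqL isT; rewrite scale0r addr0 in h0.
  have := f_lower _ _ h0 (in_range x p A pq xr pP pqL (leqnn A)).
  rewrite opprD addrA subrr add0r is_normN// is_normZ_ge0//.
  have -> : A%:R * b = 4 * (A%:R * eta) + 2 * (l * S).
    by rewrite /b AE; field; rewrite gt_eqF//; lra.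
  have : delta * rho <= A%:R * eta.
    have := ler_wpM2r (_ : 0 <= eta * l) Q1; rewrite mulr_ge0 ?(ltW l0)//.
    by rewrite -etaE AE => /(_ isT); lra.
  by rewrite mulrDr; lra.
have [y yr phiy] := is_norm_grid_pigeonhole nN A0 phi_avg (lexx _).
exists (fun p => f (y + p)) => p q pP qP.
have pqL : (p, q) \in L by exact: allpairs_f.
have := phi_ge0 _ _ pqL yr.
(* All defects at [y] are nonnegative, so each is at most their sum. *)
have : phi (p, q) y <= s * b.
  apply: le_trans phiy; apply: (term_le _ _ _ (phi^~ y)) => // pq pqL'.
  exact: phi_ge0.
have : s * b <= eps.
  have : s * (2 * S / Q%:R) <= eps / 2.
    by rewrite mulrA ler_pdivrMr ?[_ / 2 * _]mulrC//; lra.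
  have : s * eta <= s * (delta * (2 * c)) by exact: ler_wpM2l.
  have : 0 <= delta * c by nra.
  by rewrite /b -[X in _ -> _ -> _ -> _ <= X]deltaE; lra.
have : eta <= eps by rewrite -deltaE; nra.
rewrite /phi /dir/= (is_normBC nN q) ler_norml => h1 h2 h3 h4.
by apply/andP; split; lra.
Qed.

End smoothing.

(** * Passage to the limit *)

Lemma gromov_hausdorff_lt_map (R : realType) (A : Type) (dA : A -> A -> R)
    (P : set A) (B : Type) (dB : B -> B -> R) (Q : set B) (delta : R) (b : B) :
    Q b -> (gromov_hausdorff_dist dA P dB Q < delta%:E)%E ->
  exists g : B -> A, forall u v, Q u -> Q v ->
    `|dA (g u) (g v) - dB u v| <= 2 * delta.
Proof.
move=> Qb /ereal_inf_lt[e [Z [f [g [fP gQ ->]]]]].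
move=> /ereal_inf_lt[_ [r [r0 _ sub] <-]]; rewrite lte_fin => rd.
have near u : exists a, Q u -> P a /\ mdist (f a) (g u) < delta.
  have near_Q w : Q w -> exists2 a, P a & mdist (f a) (g w) < delta.
    move=> Qw; have [_ [a Pa <-]] := sub (g w) (ex_intro2 _ _ w Qw erefl).
    by rewrite ballEmdist/= => /lt_trans/(_ rd); exists a.
  have [Qu|nQu] := pselect (Q u); first by have [a] := near_Q u Qu; exists a.
  (* Outside [Q] any value will do; the point found for [b] serves as default. *)
  by have [a] := near_Q b Qb; exists a.
have [h hP] := choice near; exists h => u v Qu Qv.
have [Pu du] := hP _ Qu; have [Pv dv] := hP _ Qv.
rewrite -(fP _ _ Pu Pv) -(gQ _ _ Qu Qv).
have := metric_triangle (f (h u)) (g u) (f (h v)).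
have := metric_triangle (g u) (g v) (f (h v)).
have := metric_triangle (g u) (f (h u)) (g v).
have := metric_triangle (f (h u)) (f (h v)) (g v).
rewrite (metric_sym (g u) (f (h u))) (metric_sym (g v) (f (h v))) ler_norml.
by move=> *; apply/andP; split; lra.
Qed.

(** The maps for finite lists are normalised by isometries so that [t0] lands in [K]. Each point
    then has bounded images, and properness gives a pointwise limit along an ultrafilter on the
    lists. *)
Lemma finitely_almost_isometric_embedding (R : realType) (X : metricType R)
    (T : eqType) (dT : T -> T -> R) (t0 : T) :
    proper_space X -> cocompact_isometry_group X ->
    (forall (P : seq T) (eps : R), 0 < eps ->
      exists f : T -> X, forall p q, p \in P -> q \in P ->
        `|mdist (f p) (f q) - dT p q| <= eps) ->
  exists f : T -> X, forall u v, mdist (f u) (f v) = dT u v.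
Proof.
move=> pX [K cK coverK] fin.
have fin_K (P : seq T) : exists f : T -> X, K (f t0) /\
    forall p q, p \in P -> q \in P ->
      `|mdist (f p) (f q) - dT p q| <= (size P).+1%:R^-1.
  have [|f fP] := fin P (size P).+1%:R^-1; first by rewrite invr_gt0.
  have : (\bigcup_(g in @isometry_group R X) (g @` K)) (f t0) by rewrite coverK.
  move=> [g [g_iso [g' gK g'K]] [x Kx gx]]; exists (g' \o f).
  split; first by rewrite /= -gx gK.
  by move=> p q pP qP /=; rewrite -g_iso !g'K; exact: fP.
have [F FP] := choice fin_K.
(* Besides eventually containing any given points, the lists must grow in length, so that the error
   [1 / (size P + 1)] tends to 0 even when [T] is finite. *)
pose G := [set A : set (seq T) | exists P0, forall P,
  {subset P0 <= P} -> (size P0 <= size P)%N -> A P].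
have pG : ProperFilter G.
  split; first by move=> [P0 /(_ P0 (fun=> id) (leqnn _))].
  split.
  - by exists [::].
  - move=> A B [P1 h1] [P2 h2]; exists (P1 ++ P2) => P sub.
    rewrite size_cat => szP; split.
      by apply: h1 => [p pP|]; [apply: sub; rewrite mem_cat pP|lia].
    by apply: h2 => [p pP|]; [apply: sub; rewrite mem_cat pP orbT|lia].
  - by move=> A B AB [P0 h]; exists P0 => P *; apply/AB/h.
have [U [uU sGU]] := ultraFilterLemma pG.
have U_close u v eps : 0 < eps ->
    U [set P | `|mdist (F P u) (F P v) - dT u v| <= eps].
  move=> eps0; apply: sGU.
  (* The copies of [u] only force the length above [1 / eps]. *)
  exists (u :: v :: nseq (Num.truncn eps^-1) u) => P sub.
  rewrite /= size_nseq => szP.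
  have uP : u \in P by apply: sub; rewrite mem_head.
  have vP : v \in P by apply: sub; rewrite !inE eqxx orbT.
  apply: le_trans ((FP P).2 _ _ uP vP) _; rewrite invf_ple ?posrE//.
  apply: ltW; have := truncn_itv (ltW (_ : 0 < eps^-1)).
  rewrite invr_gt0 => /(_ eps0).
  by move=> /andP[_ /lt_le_trans]; apply; rewrite ler_nat; lia.
have [k0 k0P] : exists k0, forall e, 0 < e -> U [set P | mdist (F P t0) k0 < e].
  by apply: (compact_ultralimit _ cK); apply: filterE => P; exact: (FP P).1.
have lim u : exists l, forall e, 0 < e -> U [set P | mdist (F P u) l < e].
  (* One unit covers the distance from [F P t0] to [k0], the other the error of [F P]. *)
  apply: (compact_ultralimit _ (pX k0 (dT t0 u + 2))).
  apply: filterS (filterI (k0P 1 ltr01) (U_close t0 u 1 ltr01)) => P /= [h1].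
  rewrite /mclosed_ball/=; rewrite ler_norml => /andP[_ h2].
  have := metric_triangle k0 (F P t0) (F P u).
  by rewrite (metric_sym k0 (F P t0)); lra.
have [f fP] := choice lim; exists f => u v.
apply/eqP; rewrite -subr_eq0 -normr_le0; apply/ler_addgt0Pr => e e0.
have e3 : 0 < e / 3 by lra.
have [P [/= [hu hv]]] := filter_ex
  (filterI (filterI (fP u _ e3) (fP v _ e3)) (U_close u v _ e3)).
have := metric_triangle (f u) (F P u) (f v).
have := metric_triangle (F P u) (F P v) (f v).
have := metric_triangle (F P u) (f u) (F P v).
have := metric_triangle (f u) (f v) (F P v).
rewrite (metric_sym (f u) (F P u)) (metric_sym (f v) (F P v)) !ler_norml.
by move=> ? ? ? ? /andP[? ?]; apply/andP; split; lra.
Qed.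

Theorem theorem1p1 (R : realType) (X : metricType R) (sigma : X -> X -> R -> X)
    (n : nat) (N : 'rV[R]_n -> R) (r : nat -> R) (S_ : nat -> set X) :
  proper_space X ->
  bicombing sigma ->
  cocompact_isometry_group X ->
  (0 < n)%N ->
  is_norm N ->
  (forall k, 0 < r k) ->
  r k @[k --> \oo] --> +oo ->
  gromov_hausdorff_dist (fun x y : X => (r k)^-1 * mdist x y) (S_ k)
    (fun u v : 'rV[R]_n => N (u - v)) [set v | N v <= 1]
    @[k --> \oo] --> 0%:E ->
  exists f : 'rV[R]_n -> X, forall u v, mdist (f u) (f v) = N (u - v).
Proof.
move=> pX bs coX _ nN r0 roo gh0.
have [m [mC m_id m_conical]] := symmetric_midpoint bs pX.
apply: (finitely_almost_isometric_embedding 0 pX coX) => P eps.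
apply: (finite_almost_isometry nN mC m_id m_conical) => delta M delta0.
have d2 : 0 < delta / 2 by lra.
have gh_small : \forall k \near \oo,
    ((gromov_hausdorff_dist (fun x y : X => (r k)^-1 * mdist x y) (S_ k)
      (fun u v : 'rV[R]_n => N (u - v)) [set v | N v <= 1])%R
      < (delta / 2)%:E)%E.
  exact: gh0 _ (@nbhs_open_ereal_lt R 0 (fun=> delta / 2) d2).
have [k [/= ghk Mk]] := filter_ex (filterI gh_small ((cvgryPgt _).1 roo M)).
have [|g gP] := gromov_hausdorff_lt_map (b := 0) _ ghk.
  by rewrite /= is_norm0.
have rV0 : 0 <= (r k)^-1 by rewrite invr_ge0 ltW.
have scale_ball x : N x <= r k -> N ((r k)^-1 *: x) <= 1.
  by move=> xr; rewrite (is_normZ_ge0 nN)// mulrC ler_pdivrMr ?mul1r.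
(* Undoing the rescaling multiplies the error [2 * (delta / 2)] by [r k], which is the radius
   [rho]. *)
exists (r k), (fun x => g ((r k)^-1 *: x)); split; first exact: ltW.
move=> x y /scale_ball xr /scale_ball yr; have := gP _ _ xr yr.
rewrite -scalerBr (is_normZ_ge0 nN)// -mulrBr normrM ger0_norm//.
by rewrite mulrC ler_pdivrMr//; lra.
Qed.
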